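(* Let $H$ be an $\ell$-graph with $v(H)>\ell$ and let $\epsilon>0$. For some $c>0$ and for $N$ sufficiently large, there exists a collection $\mathcal{C}$ of 2-coloured $\ell$-multigraphs on vertex set $[N]$ such that (a) for every $\ell$-graph $I$ on vertex set $[N]$ with no induced copy of $H$ there exists $C\in\mathcal{C}$ with $I\subset C$; (b) for every $C\in\mathcal{C}$, the number of copies of $H$ in $C$ is at most $\epsilon N^{v(H)}$; (c) $\displaystyle \log|\mathcal{C}|\le c\,N^{\ell-(v(H)-\ell)/\left(\binom{v(H)}{\ell}-1\right)}\log N$.
   Context: An $\ell$-graph is an $\ell$-uniform hypergraph; $v(H)$ is the number of vertices of $H$; $[N]^{(\ell)}$ is the set of $\ell$-element subsets of $[N]=\{1,\ldots,N\}$. An induced copy of $H$ in an $\ell$-graph $I$ is an induced subgraph of $I$ isomorphic to $H$. A 2-coloured $\ell$-multigraph $C$ on vertex set $[N]$ is a pair of edge sets $C_R,C_B\subset[N]^{(\ell)}$ (red and blue edges; they may intersect). For an $\ell$-graph $I$ on $[N]$, write $I\subset C$ if $E(I)\subset C_R$ and $[N]^{(\ell)}\setminus E(I)\subset C_B$. A copy of $H$ in $C$ is an $\ell$-graph $H'$ isomorphic to $H$ with vertex set $W\subset[N]$, such that $E(H')\subset C_R$ and $W^{(\ell)}\setminus E(H')\subset C_B$. *)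

(* Defs.v *)
From HB Require Import structures.
From mathcomp Require Import all_boot.

Set Implicit Arguments.
Unset Strict Implicit.
Unset Printing Implicit Defensive.

Definition lsets (l : nat) (T : finType) (W : {set T}) : {set {set T}} :=
  [set e : {set T} | e \subset W & #|e| == l].

(* An l-graph whose vertex set is the whole of T; v(H) is #|T|. *)
Record lgraph (l : nat) (T : finType) := LGraph {
  edges :> {set {set T}};
  edges_uniform : edges \subset lsets l [set: T] }.

HB.instance Definition _ (l : nat) (T : finType) :=
  [isSub for @edges l T].
HB.instance Definition _ (l : nat) (T : finType) :=
  [Finite of lgraph l T by <:].

(* A pair (C_R, C_B) of l-uniform edge sets, which may intersect. *)
Definition mgraph (l : nat) (T : finType) : predArgType :=
  (lgraph l T * lgraph l T)%type.

HB.instance Definition _ (l : nat) (T : finType) :=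
  Finite.on (mgraph l T).

Definition red (l : nat) (T : finType) (C : mgraph l T) : lgraph l T := C.1.
Definition blue (l : nat) (T : finType) (C : mgraph l T) : lgraph l T := C.2.

Section Copies.
Variables (l : nat) (V T : finType) (H : lgraph l V).

(* H is isomorphic to the hypergraph with vertex set W and edge set F; F
   consists of l-subsets of W as soon as this holds. *)
Definition isomorphic (W : {set T}) (F : {set {set T}}) : bool :=
  [exists f : {ffun V -> T},
    [&& injectiveb f,
        f @: [set: V] == W
      & [set f @: (e : {set V}) | e in edges H] == F]].

Definition induced_edges (I : lgraph l T) (W : {set T}) : {set {set T}} :=
  [set e in edges I | e \subset W].

Definition has_induced_copy (I : lgraph l T) : bool :=
  [exists W : {set T}, isomorphic W (induced_edges I W)].

(* A copy is a subgraph (vertex set, edge set), not an embedding of H, so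
   automorphisms of H do not contribute to the number of copies. *)
Definition copies (C : mgraph l T) : {set {set T} * {set {set T}}} :=
  [set H' : {set T} * {set {set T}} |
    [&& isomorphic H'.1 H'.2,
        H'.2 \subset edges (red C)
      & lsets l H'.1 :\: H'.2 \subset edges (blue C)]].

End Copies.

(* The relation written I \subset C for multigraphs C. *)
Definition contained (l : nat) (T : finType) (I : lgraph l T)
    (C : mgraph l T) : bool :=
  (edges I \subset edges (red C)) &&
  (lsets l [set: T] :\: edges I \subset edges (blue C)).

(* Main.v *)
Require Import Defs.
From mathcomp Require Import all_boot all_order all_algebra.
From mathcomp Require Import reals exp.
From mathcomp Require Import ring lra zify.

(** The statement is an instance of the hypergraph container method.  Put
    r = 'C(v(H), l).  A copy of H on a vertex set W is a choice, for each of
    the r many l-subsets of W, of one of two colours, hence an r-edge on the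
    ground set U of coloured l-sets.  An l-graph I is the set of coloured
    l-sets that gives each l-set its true colour, and I has no induced copy of
    H iff this set contains no r-edge.  A 2-coloured multigraph is just an
    arbitrary subset of U, and it contains the copies of H that are r-edges
    inside it.  So a small family of containers for the independent sets of
    this r-uniform hypergraph is wanted, each containing few edges.

    The container theorem ([containers]) is proved for weighted hypergraphs,
    normalised so that the total weight is of order n = |U| and the edges
    through a set S of size j >= 1 weigh at most K tau^(j-1) ([spread]).  Its
    core is [avoidable_sets]: if the total weight is at least c n, then few
    sets B, each of size at least delta n, suffice for every independent set I
    to avoid one of them.  This goes by induction on the uniformity s.  From w
    on (s+1)-sets one grows a weight w' on s-sets: given a vertex v of I, add
    to w' the link of v in w, divided by tau, restricted to edges that contain
    no set already heavier in w' than in w.  Then w' remains spread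
    ([spread_link]) and I remains independent for it.  Call v heavy if this
    addition has weight at least a constant times 1/tau.  As long as w' is
    light few edges of w have been excluded, so linearly many vertices are
    heavy ([card_heavy]).  Either I avoids all of them, and they form the
    required B, or I contains one of at most n heavy vertices, and one branches
    over which it is.  After at most m steps, where m >= tau n, the weight w'
    has become linear in n, and the induction hypothesis applies to it.  The
    number of leaves is therefore n^O(m).  Deleting B from U and
    iterating a bounded number of times leaves a set with little weight inside.

    For copies of H the exponent in tau = N^-((v(H)-l)/(r-1)) is dictated by
    the degree condition for a single edge.  The sets S that lie between a
    vertex and an edge satisfy the condition because ('C(u,l)-1)/(u-l) is
    nondecreasing in u ([bin_slope]). *)

Set Implicit Arguments.
Unset Strict Implicit.
Unset Printing Implicit Defensive.

Import Order.TTheory GRing.Theory Num.Theory.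
Local Open Scope ring_scope.

(** * Weighted hypergraphs and their links *)

Section Weighted.
Variables (R : realFieldType) (T : finType).
Implicit Types (w g : {set T} -> R) (S U I e f : {set T}).

Definition degree w S : R := \sum_(e : {set T} | S \subset e) w e.

(** The degree bound for nonempty S only: nothing limits the total weight
    [degree w set0] from above. *)
Definition spread s (K tau : R) U w : Prop :=
  [/\ forall e, 0 <= w e,
      forall e, w e != 0 -> #|e| = s /\ e \subset U
    & forall S, S != set0 -> degree w S <= K * tau ^+ #|S|.-1].

Definition independent w I : Prop := forall e, w e != 0 -> ~~ (e \subset I).

(** Comparing w' with w itself, instead of with a fixed threshold, makes the
    total w-degree of the offending sets S at most the sum of all w'-degrees;
    see [degree_good_part]. *)
Definition good w w' e : bool :=
  [forall S : {set T}, (S != set0) && (S \subset e) ==>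
    (degree w' S <= degree w S)].

Definition good_part w w' e : R := if good w w' e then w e else 0.

Definition link v g f : R := if v \notin f then g (v |: f) else 0.

Lemma le_degree w g S : (forall e, w e <= g e) -> degree w S <= degree g S.
Proof. by move=> le_wg; apply: ler_sum. Qed.

Lemma degree_ge0 w S : (forall e, 0 <= w e) -> 0 <= degree w S.
Proof. by move=> w0; apply: sumr_ge0. Qed.

Lemma good_part_ge0 w w' e : (forall e, 0 <= w e) -> 0 <= good_part w w' e.
Proof. by rewrite /good_part; case: ifP. Qed.

Lemma good_part_le w w' e : (forall e, 0 <= w e) -> good_part w w' e <= w e.
Proof. by rewrite /good_part; case: ifP. Qed.

Lemma degree_link v g S :
  degree (link v g) S = if v \in S then 0 else degree g (v |: S).
Proof.
rewrite /degree /link; case: ifP => [vS | vNS].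
  by apply: big1 => f /subsetP/(_ v vS) ->.
rewrite -big_mkcondr.
rewrite (reindex_onto (fun e => e :\ v) (fun f => v |: f)) /=; last first.
  by move=> f /andP[_ vf]; rewrite setU1K.
apply: eq_big => [e | e /andP[_ /eqP ->] //].
rewrite setD11 andbT subUset sub1set subsetD1 vNS andbT andbC.
have [ve | vNe] := boolP (v \in e); first by rewrite setD1K ?eqxx.
apply/negbTE; rewrite negb_and; apply/orP; left.
by apply: contraNneq vNe => <-; rewrite setU11.
Qed.

Lemma degree0_neq w : degree w set0 != 0 -> exists e, w e != 0.
Proof.
move=> w0; apply/existsP; apply: contraNT w0.
rewrite negb_exists => /forallP w0.
by apply/eqP/big1 => e _; apply/eqP/negPn/w0.
Qed.

(** An edge that is not good contains some S with
    [degree w S < degree w' S], so the excluded weight is at most the sum of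
    [degree w S] over these S, hence at most the sum of [degree w' S] over all
    S; an s-set has 2^s subsets. *)
Lemma degree_good_part s w w' :
    (forall e, 0 <= w e) -> (forall e, 0 <= w' e) ->
    (forall e, w' e != 0 -> #|e| = s) ->
  degree w set0 - (2 ^ s)%:R * degree w' set0
    <= degree (good_part w w') set0.
Proof.
move=> w0 w'0 us; rewrite lerBlDr -lerBlDl /degree -sumrB.
pose sat (S : {set T}) := (S != set0) && (degree w S < degree w' S).
apply: (@le_trans _ _ (\sum_(e : {set T})
    \sum_(S : {set T} | sat S && (S \subset e)) w e)).
  rewrite (eq_bigl xpredT) => [|e]; last by rewrite sub0set.
  apply: ler_sum => e _; rewrite /good_part.
  case: ifPn => [_ | ]; first by rewrite subrr sumr_ge0.
  rewrite negb_forall subr0 => /existsP[S].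
  rewrite negb_imply -ltNge => /andP[/andP[S0 Se] satS].
  by rewrite (bigD1 S) /= ?lerDl ?sumr_ge0 // /sat S0 satS Se.
rewrite (exchange_big_dep sat) /=; last by move=> e S _ /andP[].
apply: (@le_trans _ _ (\sum_S degree w' S)).
  rewrite big_mkcond; apply: ler_sum => S _.
  case: ifP => [satS | _]; last exact: degree_ge0.
  rewrite satS; case/andP: satS => _ /ltW; exact: le_trans.
rewrite /degree (exchange_big_dep xpredT) //= mulr_sumr.
rewrite [leRHS](eq_bigl xpredT) => [|e]; last by rewrite sub0set.
apply: ler_sum => f _; rewrite sumr_const.
have [->|/us <-] := eqVneq (w' f) 0; first by rewrite mul0rn mulr0.
rewrite -card_powerset mulr_natl ler_wpMn2l //.
by apply/eq_leq/eq_card => S; rewrite powersetE.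
Qed.

Lemma sum_degree1 s U w :
    (forall e, 0 <= w e) ->
    (forall e, w e != 0 -> #|e| = s.+1 /\ e \subset U) ->
  degree w set0 <= \sum_(v in U) degree w [set v].
Proof.
move=> w0 us; rewrite /degree (exchange_big_dep xpredT) //=.
rewrite [leLHS](eq_bigl xpredT) => [|e]; last by rewrite sub0set.
apply: ler_sum => e _; have [->|/us[es eU]] := eqVneq (w e) 0.
  by rewrite sumr_ge0.
have /card_gt0P[v ve]: (0 < #|e|)%N by rewrite es.
by rewrite (bigD1 v) /= ?lerDl ?sumr_ge0 ?sub1set ?ve ?(subsetP eU).
Qed.

(** If [degree w' S] exceeds [degree w S], no good edge contains S and the
    degree of S does not change.  Otherwise it is at most K tau^(|S|-1), and
    the link adds at most 1/tau times the w-degree of v |: S, that is, at most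
    K tau^(|S|-1) again.  So the factor 2 survives any number of additions. *)
Lemma spread_link s K tau U w w' v : 0 < tau ->
  spread s.+1 K tau U w -> spread s (2 * K) tau U w' ->
  spread s (2 * K) tau U
    (fun f => w' f + tau^-1 * link v (good_part w w') f).
Proof.
move=> tau0 [w0 wu wd] [w'0 w'u w'd].
have link0 f : 0 <= link v (good_part w w') f.
  by rewrite /link; case: ifP => // _; apply: good_part_ge0.
have ti0 : 0 <= tau^-1 by rewrite invr_ge0 ltW.
split=> [e | e | S S0].
- by rewrite addr_ge0 // mulr_ge0.
- have [-> | /w'u//] := eqVneq (w' e) 0; rewrite add0r mulf_eq0 negb_or.
  case/andP=> _; rewrite /link; case: ifPn => [ve | ]; last by rewrite eqxx.
  rewrite /good_part; case: ifP => [_ /wu[] | ]; last by rewrite eqxx.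
  by rewrite cardsU1 ve subUset => -[<-] /andP[].
have -> : degree (fun f => w' f + tau^-1 * link v (good_part w w') f) S =
   degree w' S + tau^-1 * degree (link v (good_part w w')) S.
  by rewrite /degree big_split mulr_sumr.
rewrite degree_link; case: ifPn => [_ | vNS]; first by rewrite mulr0 addr0 w'd.
have [unsat | sat] := leP (degree w' S) (degree w S); last first.
  rewrite [degree (good_part _ _) _]big1 ?mulr0 ?addr0 ?w'd // => e.
  rewrite subUset /good_part => /andP[_ Se]; case: ifP => // /forallP/(_ S).
  by rewrite S0 Se leNgt sat.
rewrite [2 * K]mulrDl mul1r mulrDl.
apply: lerD; first exact: le_trans (wd S S0).
have vS0 : v |: S != set0 by apply/set0Pn; exists v; rewrite setU11.
have dvS : degree (good_part w w') (v |: S) <= K * tau ^+ #|S|.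
  have := wd _ vS0; rewrite cardsU1 vNS; apply: le_trans.
  by apply: le_degree => e; apply: good_part_le.
rewrite ler_pdivrMl // mulrCA -exprS prednK //; by rewrite card_gt0.
Qed.

(** * Branching over heavy vertices *)

(** Double counting of the good weight: it is at least 3c n/4, since w' is too
    light to exclude more than c n/4.  Vertices that are not heavy account for
    at most c n/4 of it, and each heavy vertex for at most K. *)
Lemma card_heavy s K c tau U w w' n :
    0 < K -> 0 < c -> (#|U| <= n)%N -> spread s.+1 K tau U w ->
    (forall e, 0 <= w' e) -> (forall e, w' e != 0 -> #|e| = s) ->
    c * n%:R <= degree w set0 ->
    degree w' set0 <= c / (2 ^ s.+2)%:R * n%:R ->
  c / (4 * K) * n%:R <=
    #|[set v in U | c / 4 <= degree (good_part w w') [set v]]|%:R.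
Proof.
move=> K0 c0 leUn [w0 wu wd] w'0 w'u wn w'n.
set B := [set v in U | _]; set g := good_part w w'.
have g0 e : 0 <= g e by apply: good_part_ge0.
have gu e : g e != 0 -> #|e| = s.+1 /\ e \subset U.
  by rewrite /g /good_part; case: ifP => [_ /wu|]; rewrite ?eqxx.
have lower : (3 / 4) * c * n%:R <= degree g set0.
  apply: le_trans (degree_good_part w0 w'0 w'u).
  have : (2 ^ s)%:R * degree w' set0 <= c / 4 * n%:R.
    apply: le_trans (ler_wpM2l (ler0n _ _) w'n) _.
    rewrite le_eqVlt; apply/orP; left; apply/eqP.
    rewrite !natrX !exprS; field; rewrite ?expf_neq0 // pnatr_eq0 //.
  lra.
have upper : degree g set0 <= c / 4 * n%:R + K * #|B|%:R.
  apply: le_trans (sum_degree1 g0 gu) _.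
  rewrite (bigID (mem B)) /= addrC; apply: lerD.
    apply: le_trans (_ : \sum_(v in U) c / 4 <= _); last first.
      by rewrite sumr_const mulr_natr ler_wpMn2l // divr_ge0 // ltW.
    rewrite big_mkcondr /=; apply: ler_sum => v vU.
    case: ifPn; first by rewrite inE vU -ltNge => /ltW.
    by rewrite divr_ge0 // ltW.
  apply: le_trans (_ : \sum_(v in B) K <= _); last first.
    by rewrite sumr_const mulr_natr.
  rewrite (eq_bigl (mem B)) => [|v]; last by rewrite /= inE; case: (v \in U).
  apply: ler_sum => v vB.
  have := wd [set v]; rewrite cards1 mulr1.
  have -> : [set v] != set0 by apply/set0Pn; exists v; rewrite set11.
  move=> /(_ isT); apply: le_trans; apply: le_degree => e.
  exact: good_part_le.
rewrite invfM !mulrA mulrAC ler_pdivrMr //.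
have := le_trans lower upper.
have : 0 <= c * n%:R by rewrite mulr_ge0 // ltW.
by lra.
Qed.

(** The sets of the family are the parts of U to be deleted, the complements of
    containers. *)
Definition avoidable (P : {set T} -> Prop) U (d : R) k : Prop :=
  exists Bs : {set {set T}},
    [/\ (#|Bs| <= k)%N,
        forall B, B \in Bs -> B \subset U /\ d <= #|B|%:R
      & forall I, P I -> exists2 B, B \in Bs & [disjoint I & B]].

(** A set that does not avoid B contains some v in B, and is covered by the
    family for that v. *)
Lemma avoidable_branch (P : {set T} -> Prop) U (d : R) k n (B : {set T}) :
    B \subset U -> d <= #|B|%:R -> (#|U| <= n)%N -> (0 < k)%N ->
    (forall v, v \in B -> avoidable (fun I => P I /\ v \in I) U d k) ->
  avoidable P U d (n.+1 * k).
Proof.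
move=> BU dB Un k0 branch.
have /fin_all_exists[F FP] v : exists Bs : {set {set T}}, v \in B ->
    [/\ (#|Bs| <= k)%N,
        forall B, B \in Bs -> B \subset U /\ d <= #|B|%:R
      & forall I, P I /\ v \in I -> exists2 B, B \in Bs & [disjoint I & B]].
  case: (boolP (v \in B)) => [/branch[Bs HBs] | _]; first by exists Bs.
  by exists set0.
exists (B |: \bigcup_(v in B) F v); split=> [|B' | I PI].
- rewrite cardsU1 mulSn leq_add //; first by case: (_ \notin _).
  apply: (@leq_trans (\sum_(v in B) k)).
    elim/big_ind2: _ => [|x1 x2 y1 y2 le1 le2|v vB]; first by rewrite cards0.
      by apply: leq_trans (leq_card_setU _ _) _; rewrite leq_add.
    by case: (FP v vB).
  by rewrite sum_nat_const leq_mul2r (leq_trans (subset_leq_card BU)) // orbT.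
- rewrite !inE => /predU1P[-> //|/bigcupP[v vB]].
  by case: (FP v vB) => _ FB _ /FB.
have [IB | ] := boolP [disjoint I & B]; first by exists B; rewrite ?setU11.
rewrite -setI_eq0 => /set0Pn[v]; rewrite inE => /andP[vI vB].
case: (FP v vB) => _ _ /(_ I (conj PI vI))[B' B'F IB'].
by exists B' => //; rewrite inE; apply/orP; right; apply/bigcupP; exists v.
Qed.

End Weighted.

(** * Containers *)

(** The number m plays the role of tau n, rounded up.  One uniformity step
    costs m branchings, whence the bound (n+1)^(s m).  In uniformity 0 the
    empty set is the only edge, and it has positive weight, so no set is
    independent. *)
Lemma avoidable_sets (R : realFieldType) s (K c : R) : 0 < K -> 0 < c ->
  exists2 delta : R, 0 < delta &
  forall (T : finType) (U : {set T}) (n m : nat) (tau : R) w,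
    (0 < n)%N -> (#|U| <= n)%N -> 0 < tau -> tau * n%:R <= m%:R ->
    spread s K tau U w -> c * n%:R <= degree w set0 ->
  avoidable (independent w) U (delta * n%:R) (n.+1 ^ (s * m)).
Proof.
elim: s K c => [|s IHs] K c K0 c0.
  exists 1 => // T U n m tau w n0 _ _ _ [w0 wu _] wn; exists set0.
  split=> [|B | I indI]; rewrite ?cards0 ?inE //.
  have /degree0_neq[e we] : degree w set0 != 0.
    by rewrite gt_eqF // (lt_le_trans _ wn) // mulr_gt0 // ltr0n.
  have := indI e we; have [/eqP] := wu e we.
  by rewrite cards_eq0 => /eqP-> _; rewrite sub0set.
(* At weight beta n, the auxiliary weight w' excludes at most a quarter of w;
   beta <= c / 4 makes m branchings enough to reach beta n. *)
pose beta := c / (2 ^ s.+2)%:R.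
have p2 k : 0 < (2 ^ k)%:R :> R by rewrite ltr0n expn_gt0.
have beta0 : 0 < beta by rewrite divr_gt0.
have [|delta delta0 IH] := IHs (2 * K) beta _ beta0; first by rewrite mulr_gt0.
have d0 : 0 < c / (4 * K) by rewrite divr_gt0 // mulr_gt0.
exists (Num.min delta (c / (4 * K))); first by rewrite lt_min delta0.
move=> T U n m tau w n0 Un tau0 mn ws wn.
set d := Num.min _ _ * _.
have dl : d <= delta * n%:R by rewrite ler_wpM2r // ge_min lexx.
have dr : d <= c / (4 * K) * n%:R by rewrite ler_wpM2r // ge_min lexx orbT.
(* Here k bounds the number of branchings left before the total weight of w'
   reaches beta n, each contributing at least c / 4 / tau. *)
have claim k : forall w', spread s (2 * K) tau U w' ->
    beta * n%:R <= degree w' set0 + k%:R * (c / 4 / tau) ->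
    avoidable (fun I => independent w I /\ independent w' I) U d
      (n.+1 ^ (k + s * m)).
  elim: k => [|k IHk] w' w's.
    rewrite mul0r addr0 => w'n.
    have [Bs [cBs BsU indB]] := IH T U n m tau w' n0 Un tau0 mn w's w'n.
    exists Bs; split=> // [B /BsU[BU dB]|I [_ /indB//]].
    by split=> //; apply: le_trans dB.
  move=> w'k; have [w'n | /ltW w'n] := leP (beta * n%:R) (degree w' set0).
    have [Bs [cBs BsU indB]] := IH T U n m tau w' n0 Un tau0 mn w's w'n.
    exists Bs; split=> [|B /BsU[BU dB]|I [_ /indB//]].
      by apply: leq_trans cBs _; rewrite leq_exp2l // leq_addl.
    by split=> //; apply: le_trans dB.
  rewrite addSn expnS; have [w'0 w'u _] := w's.
  have heavy := card_heavy K0 c0 Un ws w'0 (fun e h => (w'u e h).1) wn w'n.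
  apply: (avoidable_branch _ (le_trans dr heavy)) => //.
  - by apply/subsetP => v; rewrite inE => /andP[].
  - by rewrite expn_gt0.
  move=> v; rewrite inE => /andP[vU gv].
  have w''s := spread_link v tau0 ws w's.
  have [|Bs [cBs BsU indB]] := IHk _ w''s.
    apply: (le_trans w'k).
    have -> : degree (fun f => w' f + tau^-1 * link v (good_part w w') f) set0
        = degree w' set0 + tau^-1 * degree (link v (good_part w w')) set0.
      by rewrite /degree big_split mulr_sumr.
    rewrite degree_link inE setU0 -addrA lerD2l -natr1 mulrDl mul1r.
    rewrite [leLHS]addrC.
    by rewrite lerD2r [leLHS]mulrC ler_wpM2l // invr_ge0 ltW.
  exists Bs; split=> // I [[indw indw'] vI]; apply: indB; split=> // f.
  have [-> | w'f _] := eqVneq (w' f) 0; last exact: indw'.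
  rewrite add0r mulf_eq0 negb_or /link => /andP[_].
  case: ifP => _; last by rewrite eqxx.
  rewrite /good_part; case: ifP => _; last by rewrite eqxx.
  by move=> /indw; apply: contraNN => fI; rewrite subUset sub1set vI.
have zs : spread s (2 * K) tau U (fun=> 0).
  split=> // [e|S _]; first by rewrite eqxx.
  rewrite /degree big1 // mulr_ge0 // ?exprn_ge0 ?mulr_ge0 // ltW //.
have [|Bs [cBs BsU indB]] := claim m _ zs.
  rewrite /degree big1 // add0r mulrA ler_pdivlMr // -mulrA.
  rewrite [n%:R * _]mulrC [leLHS]mulrC.
  apply: ler_pM => //; [by rewrite mulr_ge0 // ltW | exact: ltW |].
  rewrite /beta ler_wpM2l ?(ltW c0) // lef_pV2 ?posrE // ler_nat.
  by rewrite (@leq_exp2l 2 2 s.+2).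
exists Bs; split=> // I indI.
by apply: indB; split=> // e; rewrite eqxx.
Qed.

(** While U carries weight more than eps n, [avoidable_sets] deletes at least
    delta n of its elements, for a delta that depends on eps, K and s only.
    This can happen at most 1/delta times, so only the exponent a grows. *)
Lemma containers (R : archiRealFieldType) s (K eps : R) : 0 < K -> 0 < eps ->
  exists a : nat, forall (T : finType) (U : {set T}) (n m : nat) (tau : R) w,
    (0 < n)%N -> (#|U| <= n)%N -> 0 < tau -> tau * n%:R <= m%:R ->
    spread s K tau U w ->
  exists Cs : {set {set T}},
    [/\ (#|Cs| <= n.+1 ^ (a * m))%N,
        forall C : {set T}, C \in Cs -> C \subset U /\
          \sum_(e : {set T} | e \subset C) w e <= eps * n%:R
      & forall I : {set T}, I \subset U -> independent w I ->
          exists2 C, C \in Cs & I \subset C].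
Proof.
move=> K0 eps0; have [delta delta0 avoid] := avoidable_sets s K0 eps0.
pose k0 := (Num.truncn delta^-1).+1.
exists (k0 * s)%N => T U n m tau w n0 Un tau0 mn ws.
have k0P : #|U|%:R < k0%:R * (delta * n%:R).
  apply: (@le_lt_trans _ _ n%:R); first by rewrite ler_nat.
  by rewrite mulrA ltr_pMl ?ltr0n // -ltr_pdivrMr // mul1r truncnS_gt.
elim: k0 U Un w ws k0P => [|k IHk] U Un w ws.
  by rewrite mul0r ltNge ler0n.
move=> Uk; have [w0 wu wd] := ws.
have [small | /ltW big] := leP (degree w set0) (eps * n%:R).
  exists [set U]; split=> [|C|I IU _]; last by exists U; rewrite ?set11.
    by rewrite cards1 expn_gt0.
  move/set1P->; split=> //; apply: le_trans small; rewrite /degree.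
  rewrite [leRHS](eq_bigl xpredT) => [|e]; last by rewrite sub0set.
  by rewrite big_mkcond; apply: ler_sum => e _; case: ifP.
have [Bs [cBs BsU indB]] := avoid T U n m tau w n0 Un tau0 mn ws big.
have /fin_all_exists[F FP] (B : {set T}) :
  exists Cs : {set {set T}}, B \in Bs ->
    [/\ (#|Cs| <= n.+1 ^ (k * s * m))%N,
        forall C : {set T}, C \in Cs -> C \subset U /\
          \sum_(e : {set T} | e \subset C) w e <= eps * n%:R
      & forall I : {set T}, I \subset U :\: B -> independent w I ->
          exists2 C, C \in Cs & I \subset C].
  case: (boolP (B \in Bs)) => [BBs | _]; last by exists set0.
  have [BU dB] := BsU B BBs.
  pose w2 (e : {set T}) := if e \subset U :\: B then w e else 0.
  have w2w e : w2 e <= w e by rewrite /w2; case: ifP.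
  have w2s : spread s K tau (U :\: B) w2.
    split=> [e|e|S S0]; first by rewrite /w2; case: ifP.
      by rewrite /w2; case: ifP => [eUB /wu[]|]; rewrite ?eqxx.
    exact: le_trans (le_degree _ w2w) (wd S S0).
  have UBn : (#|U :\: B| <= n)%N.
    exact: leq_trans (subset_leq_card (subsetDl U B)) Un.
  have UBk : #|U :\: B|%:R < k%:R * (delta * n%:R).
    rewrite cardsD (setIidPr BU) natrB ?subset_leq_card // ltrBlDr.
    by apply: (lt_le_trans Uk); rewrite -natr1 mulrDl mul1r lerD2l.
  have [Cs [cCs CsU indC]] := IHk _ UBn _ w2s UBk.
  exists Cs => _; split=> // [C /CsU[CUB w2C] | I IUB indI].
    split; first exact: subset_trans CUB (subsetDl U B).
    apply: le_trans w2C; apply: ler_sum => e eC.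
    by rewrite /w2 (subset_trans eC CUB).
  apply: indC => // e; rewrite /w2; case: ifP => [_|]; last by rewrite eqxx.
  exact: indI.
exists (\bigcup_(B in Bs) F B); split=> [|C /bigcupP[B BBs]|I IU indI].
- apply: (@leq_trans (\sum_(B in Bs) n.+1 ^ (k * s * m))).
    elim/big_ind2: _ => [|x1 x2 y1 y2 le1 le2|B BBs]; first by rewrite cards0.
      by apply: leq_trans (leq_card_setU _ _) _; rewrite leq_add.
    by case: (FP B BBs).
  by rewrite sum_nat_const mulSn mulnDl expnD leq_mul2r cBs orbT.
- by case: (FP B BBs) => _ FC _ /FC.
have [B BBs IB] := indB I indI.
have [_ _ indC] := FP B BBs.
have [|C CF IC] := indC I _ indI; first by rewrite subsetD IU.
by exists C => //; apply/bigcupP; exists B.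
Qed.

(** * Slopes of binomial coefficients *)

Lemma bin_le_expn n m : ('C(n, m) <= n ^ m)%N.
Proof.
elim: m n => [|m IHm] [|n]; rewrite ?bin0 ?expn0 ?bin0n //.
apply: (@leq_trans (n.+1 * 'C(n, m))).
  by rewrite mul_bin_diag leq_pmull.
rewrite expnS leq_mul2l /= (leq_trans (IHm n)) //.
by case: m {IHm} => // m; rewrite leq_exp2r.
Qed.

(** 'C(l+1+k, l+1) - 1 is the sum of the k increments up to l+1+k, each
    of them at most the increment 'C(l+1+k, l) that follows. *)
Lemma bin_step_ge l k :
  ('C(l.+1 + k, l.+1).-1 <= k * 'C(l.+1 + k, l))%N.
Proof.
elim: k => [|k IHk]; first by rewrite addn0 binn.
have := leq_bin2l l (leqnSn (l.+1 + k)); rewrite addnS binS.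
have : (0 < 'C(l.+1 + k, l.+1))%N by rewrite bin_gt0 leq_addr.
move: IHk; set a := 'C(_, l.+1); set d := 'C(_, l); set d' := 'C(_, l).
move=> IH a0 dd'.
have : (k.+1 * d <= k.+1 * d')%N by rewrite leq_mul2l dd' orbT.
by rewrite mulSn; lia.
Qed.

(** The function 'C(u, l) of u has nondecreasing increments, so its slopes from
    u = l, where it is 1, are nondecreasing too. *)
Lemma bin_slope l u v : (0 < l)%N -> (l <= u <= v)%N ->
  ('C(u, l).-1 * (v - l) <= 'C(v, l).-1 * (u - l))%N.
Proof.
case: l => // l _ /andP[/subnKC <-]; set k := (u - _)%N => /subnKC <-.
set i := (v - _)%N; rewrite -addnA !addKn.
elim: i => [|i IHi]; first by rewrite addn0.
have := bin_step_ge l (k + i).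
have : (0 < 'C(l.+1 + (k + i), l.+1))%N by rewrite bin_gt0 leq_addr.
rewrite !addnS binS; move: IHi; set a := 'C(l.+1 + k, _).-1.
set b := 'C(_, l.+1); set d := 'C(_, l); set m := (k + i)%N.
move=> IHi b0 dm; have [/eqP | m0] := posnP m.
  by rewrite addn_eq0 => /andP[/eqP k0 _]; rewrite /a k0 addn0 binn.
rewrite -(leq_pmul2r m0); nia.
Qed.

(** * The hypergraph of copies of H *)

Section CopyHypergraph.
Variables (l : nat) (V T : finType) (H : lgraph l V).
Implicit Types (W S : {set T}) (F : {set {set T}}).
Local Notation coloured_edge := ({set T} * bool)%type.

(** Red is [true].  Besides the edges of the hypergraph of copies, this gives
    the independent set attached to an l-graph I, as
    [copy_edge [set: T] (edges I)]. *)
Definition copy_edge W F : {set coloured_edge} :=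
  [set x | x.1 \in if x.2 then F else lsets l W :\: F].

Lemma copy_edge_sub W F (A : {set coloured_edge}) :
  copy_edge W F \subset A =
  (F \subset [set e | (e, true) \in A]) &&
  (lsets l W :\: F \subset [set e | (e, false) \in A]).
Proof.
apply/subsetP/andP => [sA | [/subsetP sF /subsetP sWF] [e [] ]].
- by split; apply/subsetP => e eF; rewrite inE; apply: sA; rewrite inE.
- by rewrite inE => /sF; rewrite inE.
- by rewrite inE => /sWF; rewrite inE.
Qed.

Lemma isomorphic_uniform W F :
  isomorphic H W F -> #|W| = #|V| /\ F \subset lsets l W.
Proof.
case/existsP=> f /and3P[/injectiveP f_inj /eqP <- /eqP <-].
split; first by rewrite card_imset // cardsT.
apply/subsetP => _ /imsetP[e eH ->].
have /setIdP[_ /eqP ce] := subsetP (edges_uniform H) e eH.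
by rewrite inE imsetS ?subsetT //= card_imset // ce.
Qed.

Lemma card_lsets W : #|lsets l W| = 'C(#|W|, l).
Proof. exact: cards_draws. Qed.

Lemma copy_edge_uniform W F : F \subset lsets l W ->
  forall x, x \in copy_edge W F -> x.1 \in lsets l W.
Proof.
by move=> /subsetP FW [e b]; rewrite inE /=; case: b => [/FW | /setDP[]].
Qed.

Lemma copy_edge_fst_inj W F : {in copy_edge W F &, injective fst}.
Proof.
move=> [e b] [e' b'] /[!inE] /= eF e'F ee'; rewrite -{}ee' in e'F *.
congr (_, _); case: b b' eF e'F => [] [] //.
  by move=> eF /[!inE]; rewrite eF.
by move=> /[!inE] /andP[/negbTE ->].
Qed.

Lemma card_copy_edge W F : F \subset lsets l W ->
  #|copy_edge W F| = 'C(#|W|, l).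
Proof.
move=> FW; rewrite -card_lsets -(card_in_imset (@copy_edge_fst_inj W F)).
apply: eq_card => e; apply/imsetP/idP => [[x xF ->] | eW].
  exact: copy_edge_uniform xF.
exists (e, e \in F); rewrite // inE /=; case: ifP => // eF.
by rewrite inE eF.
Qed.

Definition copies_through (A : {set coloured_edge}) :=
  [set P : {set T} * {set {set T}} |
    isomorphic H P.1 P.2 & A \subset copy_edge P.1 P.2].

Definition span (A : {set coloured_edge}) : {set T} := \bigcup_(x in A) x.1.

Lemma card_supersets S k :
  (#|[set W : {set T} | S \subset W & #|W| == k]| <= #|T| ^ (k - #|S|))%N.
Proof.
apply: leq_trans (bin_le_expn _ _); rewrite -cardsT -cards_draws.
rewrite -(@card_in_imset _ _ (fun W => W :\: S)).
  apply/subset_leq_card/subsetP => _ /imsetP[W /setIdP[SW /eqP cW] ->].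
  by rewrite inE subsetT cardsD (setIidPr SW) cW /=.
move=> W W' /setIdP[SW _] /setIdP[SW' _] eq.
by rewrite -(setID W S) -(setID W' S) eq (setIidPr SW) (setIidPr SW').
Qed.

(** A copy through A has a vertex set containing the span of A, and on each
    vertex set there are at most 2^'C(v(H), l) copies. *)
Lemma card_copies_through A :
  (#|copies_through A| <= 2 ^ 'C(#|V|, l) * #|T| ^ (#|V| - #|span A|))%N.
Proof.
pose Ws := [set W : {set T} | span A \subset W & #|W| == #|V|].
apply: (@leq_trans (\sum_(P | (P.1 \in Ws) &&
    (P.2 \in powerset (lsets l P.1))) 1)).
  rewrite sum1_card; apply/subset_leq_card/subsetP => P.
  rewrite inE => /andP[isoP AP]; have [cW FW] := isomorphic_uniform isoP.
  rewrite unfold_in /= !inE cW eqxx FW !andbT.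
  apply/bigcupsP => x xA.
  have := copy_edge_uniform FW (subsetP AP x xA).
  by rewrite inE => /andP[].
rewrite -(pair_big_dep (mem Ws) (fun W F => F \in powerset (lsets l W))
  (fun _ _ => 1%N)) /=.
rewrite mulnC.
apply: leq_trans (leq_mul (card_supersets (span A) #|V|) (leqnn _)).
rewrite -sum_nat_const; apply: leq_sum => W /setIdP[_ /eqP cW].
by rewrite sum1_card card_powerset card_lsets cW.
Qed.

(** An edge of the hypergraph of copies gives each l-set a single colour, so
    the elements of A have distinct underlying l-sets, all inside the span. *)
Lemma copies_through_span A : A != set0 -> copies_through A != set0 ->
  [/\ (l <= #|span A|)%N, (#|span A| <= #|V|)%N & (#|A| <= 'C(#|span A|, l))%N].
Proof.
case/set0Pn=> x xA /set0Pn[[W F]]; rewrite inE /= => /andP[isoP AP].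
have [cW FW] := isomorphic_uniform isoP.
have AW y : y \in A -> y.1 \in lsets l W.
  by move/(subsetP AP)/(copy_edge_uniform FW).
have Aspan y : y \in A -> y.1 \in lsets l (span A).
  by move=> yA; have /setIdP[_ cy] := AW y yA; rewrite inE cy bigcup_sup.
split.
- have /setIdP[xS /eqP <-] := Aspan x xA; exact: subset_leq_card.
- rewrite -cW; apply/subset_leq_card/bigcupsP => y yA.
  by have /setIdP[] := AW y yA.
rewrite -card_lsets -(@card_in_imset _ _ fst).
  by apply/subset_leq_card/subsetP => _ /imsetP[y yA ->]; apply: Aspan.
by move=> y z /(subsetP AP) yA /(subsetP AP) zA; apply: copy_edge_fst_inj yA zA.
Qed.

Variable R : realType.

(** There are about N^v(H) copies and N^l vertices; dividing by N^(v(H)-l)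
    makes the total weight linear in the number of vertices. *)
Definition copy_weight (x : {set coloured_edge}) : R :=
  #|[set P : {set T} * {set {set T}} |
      isomorphic H P.1 P.2 & copy_edge P.1 P.2 == x]|%:R
    / #|T|%:R ^+ (#|V| - l).

Lemma sum_copy_weight (Q : pred {set coloured_edge}) :
  \sum_(x | Q x) copy_weight x =
  #|[set P : {set T} * {set {set T}} |
      isomorphic H P.1 P.2 & Q (copy_edge P.1 P.2)]|%:R
    / #|T|%:R ^+ (#|V| - l).
Proof.
rewrite -mulr_suml; congr (_ / _); rewrite -natr_sum; congr (_%:R).
rewrite -[RHS]sum1_card (partition_big (fun P => copy_edge P.1 P.2) Q) /=.
  apply: eq_bigr => x Qx; rewrite sum1_card; apply: eq_card => P.
  rewrite inE [RHS]unfold_in /= inE.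
  by case: eqP => [->|_]; rewrite ?Qx ?andbT ?andbF.
by move=> P; rewrite inE => /andP[].
Qed.

End CopyHypergraph.

(** With u = |span A| and j = |A|, the degree of A is at most
    2^r N^(v(H)-u) / N^(v(H)-l) = 2^r N^-(u-l), and j <= 'C(u, l); so
    [bin_slope] gives N^-(u-l) <= tau^(j-1). *)
Lemma copy_weight_spread (R : realType) (l N : nat) (V : finType)
    (H : lgraph l V) : (0 < l)%N -> (l < #|V|)%N -> (0 < N)%N ->
  let r := 'C(#|V|, l) in
  let tau : R := N%:R `^ (- ((#|V|%:R - l%:R) / (r%:R - 1))) in
  spread r (2 ^ r)%:R tau [set x : {set 'I_N} * bool | #|x.1| == l]
    (@copy_weight l V 'I_N H R).
Proof.
move=> l0 lv N0 r tau.
have r1 : (1 < r)%N.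
  by apply: leq_trans (leq_bin2l l lv); rewrite binSn ltnS.
have N0R : 0 < N%:R :> R by rewrite ltr0n.
split=> [x | x | A A0].
- by rewrite /copy_weight divr_ge0 // exprn_ge0.
- rewrite /copy_weight; case: (set_0Vmem
    [set P : {set 'I_N} * {set {set 'I_N}} |
    isomorphic H P.1 P.2 & copy_edge l P.1 P.2 == x]) => [->|[[W F]]].
    by rewrite cards0 mul0r eqxx.
  rewrite inE /= => /andP[isoP /eqP <-] _.
  have [cW FW] := isomorphic_uniform isoP.
  split; first by rewrite card_copy_edge // cW.
  apply/subsetP => y /(copy_edge_uniform FW).
  by rewrite !inE => /andP[].
rewrite /degree sum_copy_weight -/(copies_through H A) card_ord.
have [->|through] := eqVneq (copies_through H A) set0.
  by rewrite cards0 mul0r mulr_ge0 ?ler0n // exprn_ge0 // powR_ge0.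
have [lu uv ju] := copies_through_span A0 through.
set u := #|span A| in lu uv ju *; set j := #|A| in ju *.
have j0 : (0 < j)%N by rewrite card_gt0.
apply: (@le_trans _ _ ((2 ^ r)%:R * N%:R ^+ (#|V| - u) / N%:R ^+ (#|V| - l))).
  rewrite ler_pM2r ?invr_gt0 ?exprn_gt0 // -natrX -natrM ler_nat.
  by have := card_copies_through H A; rewrite card_ord.
rewrite -mulrA ler_wpM2l //.
have -> : (#|V| - l = (#|V| - u) + (u - l))%N by lia.
rewrite exprD invfM mulrA divff ?expf_neq0 ?gt_eqF // mul1r.
rewrite -!powR_mulrn ?powR_ge0 // -powRN -powRrM.
apply: ler_powR; first by rewrite ler1n.
have slope : (j.-1 * (#|V| - l) <= r.-1 * (u - l))%N.
  apply: leq_trans (bin_slope l0 _); last by rewrite lu uv.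
  by rewrite leq_mul2r -!subn1 leq_sub2r ?orbT.
have r1R : 0 < r%:R - 1 :> R by rewrite subr_gt0 ltr1n.
rewrite mulNr lerN2 mulrAC ler_pdivrMr // [leLHS]mulrC.
move: slope; rewrite [leRHS]mulrC -(ler_nat R) !natrM -!subn1.
by rewrite !natrB ?(ltnW lv) ?(ltnW r1).
Qed.

(** * From containers to multigraphs *)

Definition color_class l (T : finType) (C : {set {set T} * bool}) b :=
  [set e in lsets l [set: T] | (e, b) \in C].

Lemma color_class_uniform l (T : finType) (C : {set {set T} * bool}) b :
  color_class l C b \subset lsets l [set: T].
Proof. by apply/subsetP => e; rewrite inE => /andP[]. Qed.

Definition multigraph_of l (T : finType) (C : {set {set T} * bool}) :
    mgraph l T :=
  (LGraph (color_class_uniform l C true),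
   LGraph (color_class_uniform l C false)).

Lemma copies_multigraph_of l (V T : finType) (H : lgraph l V)
    (C : {set {set T} * bool}) P :
  P \in copies H (multigraph_of l C) ->
  isomorphic H P.1 P.2 /\ copy_edge l P.1 P.2 \subset C.
Proof.
rewrite inE copy_edge_sub => /and3P[-> /subsetP sR /subsetP sB]; split=> //.
by apply/andP; split; apply/subsetP => e; [move/sR | move/sB];
  rewrite !inE => /andP[].
Qed.

Lemma contained_multigraph_of l (T : finType) (I : lgraph l T)
    (C : {set {set T} * bool}) :
  copy_edge l [set: T] (edges I) \subset C -> contained I (multigraph_of l C).
Proof.
rewrite copy_edge_sub => /andP[/subsetP sR /subsetP sB].
have IT := subsetP (edges_uniform I).
apply/andP; split; apply/subsetP => e eI; rewrite inE.
  by have := sR e eI; rewrite inE IT.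
by have := sB e eI; have /setDP[-> _] := eI; rewrite inE.
Qed.

Lemma induced_copy_of_copy_edge l (V T : finType) (H : lgraph l V)
    (I : lgraph l T) W F :
  isomorphic H W F -> copy_edge l W F \subset copy_edge l [set: T] (edges I) ->
  has_induced_copy H I.
Proof.
move=> isoP; have [_ /subsetP FW] := isomorphic_uniform isoP.
rewrite copy_edge_sub => /andP[/subsetP sF /subsetP sWF].
apply/existsP; exists W; rewrite (_ : induced_edges I W = F) //.
apply/setP => e; rewrite inE; apply/andP/idP => [[eI eW] | eF]; last first.
  by have := sF e eF; have /setIdP[-> _] := FW e eF; rewrite !inE.
apply: contraLR (eI) => eF; have /setIdP[_ ce] :=
  subsetP (edges_uniform I) e eI.
have := sWF e; rewrite !inE eF eW ce /= => /(_ isT).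
by case/andP.
Qed.

Theorem theorem2p6 (R : realType) (l : nat) (V : finType) (H : lgraph l V)
    (eps : R) (l_gt0 : (0 < l)%N) (l_lt_v : (l < #|V|)%N)
    (eps_gt0 : 0 < eps) :
  exists2 c : R, 0 < c &
  exists N0 : nat, forall N : nat, (N0 <= N)%N ->
  exists CC : {set mgraph l 'I_N},
    [/\ (forall I : lgraph l 'I_N, ~~ has_induced_copy H I ->
           exists2 C : mgraph l 'I_N, C \in CC & contained I C),
        (forall C : mgraph l 'I_N, C \in CC ->
           #|copies H C|%:R <= eps * N%:R ^+ #|V|)
      & ln (#|CC|%:R : R) <=
          c * N%:R `^ (l%:R - (#|V|%:R - l%:R) / ('C(#|V|, l)%:R - 1))
            * ln (N%:R : R)].
Proof.
set r := 'C(#|V|, l); set gamma : R := (#|V|%:R - l%:R) / (r%:R - 1).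
have K0 : 0 < (2 ^ r)%:R :> R by rewrite ltr0n expn_gt0.
have eps2 : 0 < eps / 2 by rewrite divr_gt0.
have [a cont] := containers r K0 eps2.
have c0 : 0 < (3 * a * l.+2).+1%:R :> R by rewrite ltr0n.
(* The number of containers is at most (n+1)^(a m), where n + 1 <= N^(l+2) for
   N >= 2 and m <= 3 N^alpha; the successor keeps c positive when a = 0. *)
exists (3 * a * l.+2).+1%:R => //; exists 2 => N N2.
have N0 : (0 < N)%N by apply: ltnW.
have NR1 : 1 <= N%:R :> R by rewrite ler1n.
have NR0 : 0 < N%:R :> R by rewrite ltr0n.
have gamma_le : gamma <= l%:R.
  have slope : (#|V| - l <= r.-1)%N.
    have := @bin_slope l l.+1 #|V| l_gt0; rewrite leqnSn l_lt_v => /(_ isT).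
    by rewrite binSn subSnn muln1; apply: leq_trans; rewrite leq_pmull.
  have r0 : (0 < r)%N by rewrite bin_gt0 ltnW.
  have r1 : (0 < r.-1)%N by apply: leq_trans slope; rewrite subn_gt0.
  rewrite /gamma -natrB ?(ltnW l_lt_v) // -(natrB _ r0) subn1.
  rewrite ler_pdivrMr ?ltr0n // -natrM ler_nat.
  by apply: leq_trans slope _; rewrite leq_pmull.
set alpha := l%:R - gamma.
have Na1 : 1 <= N%:R `^ alpha :> R.
  by rewrite -[leLHS](powRr0 N%:R) ler_powR // subr_ge0.
pose U := [set x : {set 'I_N} * bool | #|x.1| == l].
(* An upper bound for |U| = 2 'C(N, l) of the same order, for which
   tau n = 2 N^alpha. *)
pose n := (2 * N ^ l)%N.
pose m := (Num.truncn (2 * N%:R `^ alpha : R)).+1.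
have n0 : (0 < n)%N by rewrite muln_gt0 expn_gt0 N0.
have Un : (#|U| <= n)%N.
  have -> : U = setX (lsets l [set: 'I_N]) [set: bool].
    by apply/setP => -[e b]; rewrite !inE subsetT /= andbT.
  rewrite cardsX card_lsets !cardsT card_ord card_bool mulnC leq_mul2l /=.
  exact: bin_le_expn.
have tau0 : 0 < N%:R `^ (- gamma) :> R by rewrite powR_gt0.
have mn : N%:R `^ (- gamma) * n%:R <= m%:R :> R.
  apply/ltW; apply: le_lt_trans (truncnS_gt _).
  rewrite /n natrM natrX -powR_mulrn ?ler0n // mulrCA ler_pM2l // -powRD.
    by rewrite addrC.
  by apply/implyP => _; rewrite gt_eqF.
have ws := copy_weight_spread R H l_gt0 l_lt_v N0.
have [Cs [cCs CsU indC]] := cont _ U n m _ _ n0 Un tau0 mn ws.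
exists [set multigraph_of l C | C in Cs]; split.
- move=> I noH; set J := copy_edge l [set: 'I_N] (edges I).
  have JU : J \subset U.
    apply/subsetP => x /(copy_edge_uniform (edges_uniform I)).
    by rewrite !inE => /andP[].
  have [x | C CCs JC] := indC J JU.
    apply: contraNN => xJ; rewrite /copy_weight.
    set A := [set P | _ & _]; have [-> | ] := eqVneq A set0.
      by rewrite cards0 mul0r.
    case/set0Pn=> -[W F]; rewrite inE /= => /andP[isoP /eqP eqx].
    by case/negP: noH; apply: (induced_copy_of_copy_edge isoP); rewrite eqx.
  exists (multigraph_of l C); first exact: imset_f.
  exact: contained_multigraph_of.
- move=> _ /imsetP[C /CsU[_ wC] ->].
  have leC : (#|copies H (multigraph_of l C)| <=
    #|[set P : {set 'I_N} * {set {set 'I_N}} |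
        isomorphic H P.1 P.2 & copy_edge l P.1 P.2 \subset C]|)%N.
    apply/subset_leq_card/subsetP => P /copies_multigraph_of[isoP PC].
    by rewrite inE isoP.
  rewrite -(ler_nat R) in leC; apply: le_trans leC _.
  move: wC; rewrite sum_copy_weight card_ord ler_pdivrMr ?exprn_gt0 //.
  rewrite /n natrM natrX mulrA divfK ?pnatr_eq0 // -mulrA -exprD.
  by rewrite subnKC // ltnW.
have lnN0 : 0 <= ln N%:R :> R by rewrite ln_ge0.
set CC := [set _ | _ in _]; have [-> | CC0] := posnP #|CC|.
  by rewrite ln0 // !mulr_ge0 // ?powR_ge0 // ltW.
have CCn : (#|CC| <= (N ^ l.+2) ^ (a * m))%N.
  apply: leq_trans (leq_imset_card _ _) (leq_trans cCs _).
  have [->|am] := posnP (a * m)%N; first by rewrite !expn0.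
  rewrite leq_exp2r // /n !expnS.
  have : (0 < N ^ l)%N by rewrite expn_gt0 N0.
  set p := (N ^ l)%N => p0; apply: (@leq_trans (2 * (2 * p))); first by lia.
  by rewrite !leq_mul.
have lnCC : ln #|CC|%:R <= (l.+2 * (a * m))%:R * ln N%:R :> R.
  rewrite -expnM in CCn; rewrite mulr_natl -lnXn // ler_ln ?posrE ?ltr0n //.
    by rewrite -natrX ler_nat.
  by rewrite exprn_gt0.
apply: le_trans lnCC _; rewrite ler_wpM2r //.
have mle : m%:R <= 3 * N%:R `^ alpha :> R.
  rewrite /m -natr1.
  have : (Num.truncn (2 * N%:R `^ alpha : R))%:R <= 2 * N%:R `^ alpha :> R.
    by rewrite truncn_le mulr_ge0 ?powR_ge0.
  by move: Na1; lra.
apply: (@le_trans _ _ ((l.+2 * a)%:R * (3 * N%:R `^ alpha))).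
  by rewrite mulnA natrM ler_wpM2l.
rewrite mulrA -natrM ler_wpM2r ?powR_ge0 // ler_nat; lia.
Qed.
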